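(* Let $R>r\ge1$ and let $f,g:\mathbb{D}_{R}\to\mathbb{C}$ be analytic in $\mathbb{D}_{R}=\{z\in\mathbb{C}:|z|<R\}$, $f(z)=\sum_{k=0}^{\infty}a_{k}z^{k}$, $g(z)=\sum_{k=0}^{\infty}b_{k}z^{k}$. Then there is a constant $C(r,f,g)$, independent of $n$, such that for all $n\in\mathbb{N}$ and all $|z|\le r$, $$\left|B_{n}(fg)(z)-B_{n}(f)(z)B_{n}(g)(z)-\frac{z(1-z)f'(z)g'(z)}{n}\right|\le\frac{C(r,f,g)}{n^{2}}.$$
   Context: For a function $h$ defined on $[0,1]$, the complex Bernstein polynomials are $B_{n}(h)(z)=\sum_{k=0}^{n}\binom{n}{k}z^{k}(1-z)^{n-k}h(k/n)$, $z\in\mathbb{C}$. *)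

(* Defs.v *)
From Stdlib Require Import Reals.
From Coquelicot Require Import Coquelicot.
Open Scope R_scope.

Definition bernstein (n : nat) (h : R -> C) (z : C) : C :=
  sum_n (fun k : nat =>
           (RtoC (Binomial.C n k) * pow_n z k * pow_n (1 - z)%C (n - k)
            * h (INR k / INR n)%R)%C) n.

(* Main.v *)
(** For monomials, [B_n(e_m)(z)] is the expectation of [z] to the number of
    occupied boxes after [m] uniform throws into [n] boxes. Conditioning on one
    throw gives a recurrence in [m] from which the second order expansion
    [B_n(e_m)(z) = z^m + m(m-1)/(2n) (z^(m-1) - z^m) + O(m^4 r^m / n^2)] follows by
    induction, uniformly for [|z| <= r]. The [1/n] terms of [B_n(e_(i+j))] and of
    [B_n(e_i) B_n(e_j)] differ by exactly [z(1-z) (z^i)' (z^j)' / n], so the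
    expression in the theorem is [O((i+1)^4 (j+1)^4 r^(i+j) / n^2)] for a pair of
    monomials. It is bilinear in [(f, g)], and [sum |a_k| (k+1)^4 r^k < oo], so the
    bound holds uniformly for the partial sums of the power series and passes to the
    limit. *)
Require Import Defs.
From Stdlib Require Import Reals Lra Lia.
From Coquelicot Require Import Coquelicot.
Open Scope R_scope.

(* [ring] only recognises the equality type when it is syntactically [C]. *)
Ltac cring := match goal with |- @eq _ ?x ?y => change (@eq C x y) end; ring.

(** * Powers and finite sums of complex numbers *)

Lemma pow_n_Cpow (z : C) (k : nat) : pow_n z k = (z ^ k)%C.
Proof.
  induction k as [|k IH]; [reflexivity|].
  change (z * pow_n z k = z * z ^ k)%C. now rewrite IH.
Qed.

Lemma sum_n_Cplus (u v : nat -> C) (n : nat) :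
  sum_n (fun k => (u k + v k)%C) n = (sum_n u n + sum_n v n)%C.
Proof. exact (sum_n_plus u v n). Qed.

Lemma sum_n_Cmult (c : C) (u : nat -> C) (n : nat) :
  sum_n (fun k => (c * u k)%C) n = (c * sum_n u n)%C.
Proof. exact (sum_n_mult_l (K := C_Ring) c u n). Qed.

Lemma sum_n_CS (u : nat -> C) (n : nat) :
  sum_n u (S n) = (sum_n u n + u (S n))%C.
Proof. exact (sum_Sn u n). Qed.

Lemma sum_n_shift (u : nat -> C) (n : nat) :
  sum_n u (S n) = (u O + sum_n (fun k => u (S k)) n)%C.
Proof.
  unfold sum_n. rewrite sum_n_m_S, sum_Sn_m by lia. reflexivity.
Qed.

Lemma Cmod_sum_n (u : nat -> C) (n : nat) :
  Cmod (sum_n u n) <= sum_n (fun k => Cmod (u k)) n.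
Proof. exact (norm_sum_n_m (V := C_NormedModule) u 0 n). Qed.

(** * Moments of the Bernstein basis *)

Lemma Cbinomial (x y : C) (n : nat) :
  sum_n (fun k => (RtoC (Binomial.C n k) * x ^ k * y ^ (n - k))%C) n
  = ((x + y) ^ n)%C.
Proof.
  induction n as [|n IH].
  { rewrite sum_O, C_n_0. simpl. cring. }
  (* Degree one is treated apart: both terms of its sum are end terms, and Pascal's rule is for
     interior ones. *)
  rewrite Cpow_S, <- IH. destruct n as [|m].
  { rewrite sum_n_CS, !sum_O, C_n_n, !C_n_0. simpl. cring. }
  rewrite sum_n_CS, sum_n_shift, C_n_n, C_n_0, !Nat.sub_diag.
  rewrite (sum_n_ext_loc _ (fun k => (x * (RtoC (Binomial.C (S m) k) * x ^ k * y ^ (S m - k))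
     + y * (RtoC (Binomial.C (S m) (S k)) * x ^ (S k) * y ^ (S m - S k)))%C)).
  2:{ intros k Hk. rewrite <- pascal by lia. rewrite RtoC_plus, Cpow_S.
      replace (S (S m) - S k)%nat with (S (m - k)) by lia.
      replace (S m - k)%nat with (S (m - k)) by lia.
      replace (S m - S k)%nat with (m - k)%nat by lia.
      rewrite !Cpow_S. cring. }
  rewrite sum_n_Cplus, !sum_n_Cmult.
  rewrite Cmult_plus_distr_r.
  rewrite (sum_n_shift _ m) at 2.
  rewrite (sum_n_CS _ m).
  rewrite C_n_n, C_n_0, Nat.sub_diag, !Nat.sub_0_r. rewrite !Cpow_S. simpl Cpow. cring.
Qed.

Lemma binomial_absorption (n k : nat) :
  (k <= n)%nat -> Binomial.C (S n) (S k) * INR (S k) = INR (S n) * Binomial.C n k.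
Proof.
  intros Hk. unfold Binomial.C.
  replace (S n - S k)%nat with (n - k)%nat by lia.
  rewrite !fact_simpl, !mult_INR.
  field. repeat split; try apply INR_fact_neq_0; apply not_0_INR; lia.
Qed.

(* With [n = N + p] boxes of which [p] are occupied at the start, this is the
   expectation of [z ^ (number of occupied boxes after m throws)]. *)
Definition moment (z : C) (N p m : nat) : C :=
  sum_n (fun k => (RtoC (Binomial.C N k) * z ^ (k + p) * (1 - z) ^ (N - k)
                   * RtoC (INR (k + p) / INR (N + p)) ^ m)%C) N.

Lemma bernstein_pow (z : C) (n m : nat) :
  bernstein n (fun x => (RtoC x ^ m)%C) z = moment z n 0 m.
Proof.
  apply sum_n_ext; intros k. rewrite !pow_n_Cpow, !Nat.add_0_r. reflexivity.
Qed.

Lemma moment_0 (z : C) (N p : nat) : moment z N p 0 = (z ^ p)%C.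
Proof.
  unfold moment.
  rewrite (sum_n_ext _ (fun k => (z ^ p * (RtoC (Binomial.C N k) * z ^ k * (1 - z) ^ (N - k)))%C)).
  2:{ intros k. rewrite Cpow_add_r. simpl. cring. }
  rewrite sum_n_Cmult, Cbinomial.
  replace (z + (1 - z))%C with (RtoC 1) by ring. rewrite Cpow_1_l. ring.
Qed.

(** Condition on the first throw: with probability [p / n] it hits an occupied box, otherwise it
    fills an empty one, the total [n] being unchanged. Algebraically, one factor [(k + p) / n]
    splits as [p / n + k / n], and the [k] is absorbed into the binomial coefficient. *)
Lemma moment_S (z : C) (N p m : nat) :
  moment z (S N) p (S m)
  = (RtoC (INR p / INR (S N + p)) * moment z (S N) p m
     + RtoC (INR (S N) / INR (S N + p)) * moment z N (S p) m)%C.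
Proof.
  assert (Hn : INR (S N + p) <> 0) by (apply not_0_INR; lia).
  unfold moment at 1.
  rewrite (sum_n_ext _ (fun k => (RtoC (INR p / INR (S N + p)) *
     (RtoC (Binomial.C (S N) k) * z ^ (k + p) * (1 - z) ^ (S N - k)
                   * RtoC (INR (k + p) / INR (S N + p)) ^ m) +
     RtoC (INR k / INR (S N + p)) *
     (RtoC (Binomial.C (S N) k) * z ^ (k + p) * (1 - z) ^ (S N - k)
                   * RtoC (INR (k + p) / INR (S N + p)) ^ m))%C)).
  2:{ intros k. rewrite (Cpow_S _ m).
      replace (INR (k + p) / INR (S N + p)) with (INR p / INR (S N + p) + INR k / INR (S N + p)) at 1
        by (rewrite (plus_INR k p); field; exact Hn).
      rewrite RtoC_plus. cring. }
  rewrite sum_n_Cplus, sum_n_Cmult. f_equal.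
  (* The term [k = 0] vanishes, and shifting [k] by one turns [(S N, p)] into [(N, S p)]. *)
  rewrite sum_n_shift. unfold moment. rewrite <- sum_n_Cmult.
  replace (INR 0 / INR (S N + p)) with 0 by (simpl; field; exact Hn).
  rewrite !Cmult_0_l, Cplus_0_l.
  apply sum_n_ext_loc; intros k Hk.
  replace (S k + p)%nat with (k + S p)%nat by lia.
  replace (S N + p)%nat with (N + S p)%nat in * by lia.
  replace (S N - S k)%nat with (N - k)%nat by lia.
  enough (E : (RtoC (INR (S k) / INR (N + S p)) * RtoC (Binomial.C (S N) (S k))
       = RtoC (INR (S N) / INR (N + S p)) * RtoC (Binomial.C N k))%C).
  { rewrite !Cmult_assoc, E. cring. }
  rewrite <- !RtoC_mult. f_equal.
  replace (INR (S k) / INR (N + S p) * Binomial.C (S N) (S k))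
    with ((Binomial.C (S N) (S k) * INR (S k)) / INR (N + S p)) by (field; exact Hn).
  rewrite binomial_absorption by exact Hk. field; exact Hn.
Qed.

(** With no empty box left, a throw changes nothing; [1 <= p] makes [p / p] equal to one. *)
Lemma moment_0_S (z : C) (p m : nat) :
  (1 <= p)%nat -> moment z 0 p (S m) = moment z 0 p m.
Proof.
  intros Hp. unfold moment. rewrite !sum_O. simpl Nat.add.
  replace (INR p / INR p) with 1 by (field; apply not_0_INR; lia).
  now rewrite !Cpow_1_l.
Qed.

(** * Second order expansion of the moments *)

Lemma Cmod_pow_le (z : C) (r : R) (k l : nat) :
  1 <= r -> Cmod z <= r -> (k <= l)%nat -> Cmod (z ^ k)%C <= r ^ l.
Proof.
  intros Hr Hz Hkl. rewrite Cmod_pow.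
  apply Rle_trans with (r ^ k).
  - apply pow_incr; split; [apply Cmod_ge_0 | exact Hz].
  - now apply Rle_pow.
Qed.

Lemma Cmod_triangle_minus (x y : C) : Cmod (x - y)%C <= Cmod x + Cmod y.
Proof. unfold Cminus. rewrite <- (Cmod_opp y). apply Cmod_triangle. Qed.

Lemma Cmod_RtoC_mult (c : R) (x : C) :
  0 <= c -> Cmod (RtoC c * x)%C = c * Cmod x.
Proof. intros Hc. rewrite Cmod_mult, Cmod_R, Rabs_pos_eq; auto. Qed.

(* [collisions m p / n] is, to first order in [1 / n], the expected number of
   throws hitting an occupied box. *)
Definition collisions (m p : nat) : R := INR m * INR p + INR m * (INR m - 1) / 2.

Lemma collisions_bounds (m p : nat) : 0 <= collisions m p <= (INR m + INR p) ^ 2.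
Proof.
  unfold collisions. pose proof (pos_INR m). pose proof (pos_INR p).
  destruct m as [|m]; [simpl; nra|].
  assert (1 <= INR (S m)) by (rewrite S_INR; pose proof (pos_INR m); lra).
  split; nra.
Qed.

(** Throws without collision would give [z ^ (m + p)], and a collision lowers the exponent by one,
    whence the first order correction. If [m + p = 0], the truncated [pred] makes the two powers
    equal and the correction vanishes. *)
Definition moment_error (z : C) (N p m : nat) : C :=
  (moment z N p m - z ^ (m + p)
   - RtoC (collisions m p / INR (N + p)) * (z ^ pred (m + p) - z ^ (m + p)))%C.

(** [X] is the moment before a throw, [Z] and [Y] those after hitting an occupied or an empty box;
    [s], [t], [u] stand for [z ^ (m + p + 1)], [z ^ (m + p)], [z ^ pred (m + p)], and [r] for a
    common bound of these. [Z] is expanded around [t] instead of [s], which supplies the new term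
    [q / n * (t - s)]. The two errors enter in a convex combination, hence stay below [e]; what
    remains are two products of order [1 / n ^ 2], each at most [2 * q * be * r / n ^ 2]. *)
Lemma moment_error_step (z X Y Z s t u : C) (r q n al be e : R) :
  0 < n -> 0 <= q <= n -> 0 <= al <= be ->
  X = (RtoC (q / n) * Z + RtoC (1 - q / n) * Y)%C ->
  Cmod (Y - s - RtoC (be / n) * (t - s))%C <= e ->
  Cmod (Z - t - RtoC (al / n) * (u - t))%C <= e ->
  Cmod s <= r -> Cmod t <= r -> Cmod u <= r ->
  Cmod (X - s - RtoC ((q + be) / n) * (t - s))%C <= e + 4 * q * be * r / n ^ 2.
Proof.
  intros Hn Hq Hal HX HY HZ Hs Ht Hu.
  assert (Hth : 0 <= q / n <= 1).
  { split; [apply Rle_div_r | apply Rle_div_l]; lra. }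
  replace (X - s - RtoC ((q + be) / n) * (t - s))%C
    with (RtoC (1 - q / n) * (Y - s - RtoC (be / n) * (t - s))
          + RtoC (q / n) * (Z - t - RtoC (al / n) * (u - t))
          + (RtoC (q / n * (al / n)) * (u - t) - RtoC (q / n * (be / n)) * (t - s)))%C.
  2:{ rewrite HX. replace ((q + be) / n) with (q / n + be / n) by (field; lra).
      rewrite !RtoC_mult, RtoC_minus, RtoC_plus. ring. }
  assert (Ha : 0 <= al / n <= be / n).
  { split; [apply Rle_div_r; lra|]. apply Rmult_le_compat_r; [|lra].
    left; now apply Rinv_0_lt_compat. }
  eapply Rle_trans; [apply Cmod_triangle|].
  eapply Rle_trans;
    [apply Rplus_le_compat; [apply Cmod_triangle | apply Cmod_triangle_minus] |].
  rewrite !Cmod_RtoC_mult; try lra; try (apply Rmult_le_pos; lra).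
  pose proof (Cmod_triangle_minus u t). pose proof (Cmod_triangle_minus t s).
  replace (4 * q * be * r / n ^ 2) with (q / n * (be / n) * (4 * r)) by (field; lra).
  assert (q / n * (al / n) <= q / n * (be / n)) by (apply Rmult_le_compat_l; lra).
  assert (0 <= q / n * (al / n)) by (apply Rmult_le_pos; lra).
  assert (q / n * (al / n) * Cmod (u - t)%C <= q / n * (be / n) * (2 * r)).
  { apply Rmult_le_compat; auto; try lra. apply Cmod_ge_0. }
  assert (q / n * (be / n) * Cmod (t - s)%C <= q / n * (be / n) * (2 * r)).
  { apply Rmult_le_compat_l; lra. }
  nra.
Qed.

(** Induction on the throws, with [N + p] constant along the recursion. Errors do not accumulate
    multiplicatively: each throw adds at most [4 * p * collisions m (S p) * r ^ s / n ^ 2] with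
    [s = m + p + 1], and [p * collisions m (S p) <= s ^ 3]. *)
Lemma moment_error_bound (z : C) (r : R) (m N p : nat) :
  1 <= r -> Cmod z <= r -> (1 <= N + p)%nat ->
  Cmod (moment_error z N p m)
  <= 4 * INR m * INR (m + p) ^ 3 * r ^ (m + p) / INR (N + p) ^ 2.
Proof.
  intros Hr Hz. revert N p. induction m as [|m IH]; intros N p Hn.
  { unfold moment_error. rewrite moment_0. unfold collisions. simpl Nat.add. simpl INR.
    replace ((0 * INR p + 0 * (0 - 1) / 2) / INR (N + p)) with 0 by (field; apply not_0_INR; lia).
    replace (z ^ p - z ^ p - 0 * (z ^ pred p - z ^ p))%C with (RtoC 0) by ring.
    rewrite Cmod_0. right. field. apply not_0_INR; lia. }
  assert (HnR : 0 < INR (N + p)) by (apply lt_0_INR; lia).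
  pose proof (pos_INR p) as Hp. pose proof (pos_INR m) as Hm.
  assert (Hpn : INR p <= INR (N + p)) by (apply le_INR; lia).
  set (s := S (m + p)).
  assert (Hs : INR s = INR m + INR p + 1) by (unfold s; rewrite S_INR, plus_INR; ring).
  set (e := 4 * INR m * INR s ^ 3 * r ^ s / INR (N + p) ^ 2).
  pose proof (collisions_bounds m p) as Hc. pose proof (collisions_bounds m (S p)) as Hc'.
  assert (Hcc : collisions m (S p) = collisions m p + INR m)
    by (unfold collisions; rewrite S_INR; ring).
  assert (He : 0 <= e).
  { unfold e. apply Rle_div_r; [apply pow_lt; exact HnR|]. rewrite Rmult_0_l.
    repeat apply Rmult_le_pos; try apply pow_le; try lra. }
  assert (HZ : Cmod (moment_error z N p m) <= e).
  { eapply Rle_trans; [apply IH; exact Hn|]. unfold e, Rdiv.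
    apply Rmult_le_compat_r.
    { left. apply Rinv_0_lt_compat, pow_lt, HnR. }
    apply Rmult_le_compat.
    - repeat apply Rmult_le_pos; try apply pow_le; try apply pos_INR; lra.
    - apply pow_le; lra.
    - apply Rmult_le_compat_l; [lra|]. apply pow_incr. split; [apply pos_INR|].
      apply le_INR; unfold s; lia.
    - apply Rle_pow; [exact Hr | unfold s; lia]. }
  assert (HY : exists Y, moment z N p (S m)
      = (RtoC (INR p / INR (N + p)) * moment z N p m + RtoC (1 - INR p / INR (N + p)) * Y)%C
      /\ Cmod (Y - z ^ s - RtoC (collisions m (S p) / INR (N + p)) * (z ^ (m + p) - z ^ s))%C <= e).
  { destruct N as [|N].
    (* Without empty boxes the weight of [Y] is zero, so [Y] may be chosen with zero error. *)
    - exists (z ^ s + RtoC (collisions m (S p) / INR (0 + p)) * (z ^ (m + p) - z ^ s))%C. split.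
      + rewrite moment_0_S by exact Hn. simpl Nat.add.
        replace (INR p / INR p) with 1 by (field; apply not_0_INR; simpl in Hn; lia).
        replace (1 - 1) with 0 by ring. ring.
      + match goal with |- Cmod ?x <= _ => replace x with (RtoC 0) by ring end.
        rewrite Cmod_0. exact He.
    - exists (moment z N (S p) m). split.
      + rewrite moment_S. do 3 f_equal. rewrite plus_INR.
        rewrite plus_INR in HnR. field. lra.
      + specialize (IH N (S p) ltac:(lia)). unfold moment_error in IH.
        replace (m + S p)%nat with s in IH by (unfold s; lia).
        replace (N + S p)%nat with (S N + p)%nat in IH by lia. exact IH. }
  destruct HY as [Y [EX HY]]. unfold moment_error in *.
  replace (S m + p)%nat with s by reflexivity.
  replace (pred s) with (m + p)%nat by reflexivity.
  replace (collisions (S m) p) with (INR p + collisions m (S p))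
    by (unfold collisions; rewrite !S_INR; field).
  eapply Rle_trans.
  { eapply (moment_error_step z _ Y (moment z N p m) _ _ (z ^ pred (m + p))%C (r ^ s));
      [exact HnR | split; assumption | | exact EX | exact HY | exact HZ | | |];
      try (apply Cmod_pow_le; auto; unfold s; lia). lra. }
  unfold e. rewrite (S_INR m).
  replace (4 * (INR m + 1) * INR s ^ 3 * r ^ s / INR (N + p) ^ 2)
    with (4 * INR m * INR s ^ 3 * r ^ s / INR (N + p) ^ 2
          + 4 * INR s ^ 3 * r ^ s / INR (N + p) ^ 2) by (field; lra).
  apply Rplus_le_compat_l. unfold Rdiv. apply Rmult_le_compat_r.
  { left. apply Rinv_0_lt_compat, pow_lt, HnR. }
  apply Rmult_le_compat_r; [apply pow_le; lra|].
  rewrite S_INR in Hc'.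
  assert (collisions m (S p) <= INR s ^ 2).
  { rewrite Hs. replace (INR m + INR p + 1) with (INR m + (INR p + 1)) by ring. apply Hc'. }
  assert (INR p <= INR s) by lra.
  assert (INR p * collisions m (S p) <= INR s * INR s ^ 2).
  { apply Rmult_le_compat; lra. }
  replace (INR s ^ 3) with (INR s * INR s ^ 2) by ring. lra.
Qed.

(** * The remainder as a bilinear functional *)

Lemma bernstein_ext (n : nat) (u v : R -> C) (z : C) :
  (forall x, u x = v x) -> bernstein n u z = bernstein n v z.
Proof. intros H. apply sum_n_ext; intros k. now rewrite H. Qed.

Lemma bernstein_plus (n : nat) (u v : R -> C) (z : C) :
  bernstein n (fun x => (u x + v x)%C) z = (bernstein n u z + bernstein n v z)%C.
Proof.
  unfold bernstein. rewrite <- sum_n_Cplus. apply sum_n_ext; intros k. cring.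
Qed.

Lemma bernstein_scal (n : nat) (c : C) (u : R -> C) (z : C) :
  bernstein n (fun x => (c * u x)%C) z = (c * bernstein n u z)%C.
Proof.
  unfold bernstein. rewrite <- sum_n_Cmult. apply sum_n_ext; intros k. cring.
Qed.

(* The values [u'] and [v'] stand for the derivatives of [u] and [v] at [z];
   keeping them as free arguments makes the remainder bilinear in the pairs
   [(u, u')] and [(v, v')]. *)
Definition remainder (n : nat) (z : C) (u : R -> C) (u' : C) (v : R -> C) (v' : C) : C :=
  (bernstein n (fun x => u x * v x) z - bernstein n u z * bernstein n v z
   - z * (1 - z) * u' * v' / RtoC (INR n))%C.

(** Thanks to symmetry, linearity has to be proved in the first pair only. *)
Lemma remainder_sym (n : nat) (z : C) (u v : R -> C) (u' v' : C) :
  remainder n z u u' v v' = remainder n z v v' u u'.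
Proof.
  unfold remainder, Cdiv.
  rewrite (bernstein_ext n (fun x => u x * v x)%C (fun x => v x * u x)%C) by (intros; ring).
  ring.
Qed.

Lemma remainder_scal (n : nat) (z c : C) (u v : R -> C) (u' v' : C) :
  remainder n z (fun x => (c * u x)%C) (c * u')%C v v' = (c * remainder n z u u' v v')%C.
Proof.
  unfold remainder, Cdiv. rewrite bernstein_scal.
  rewrite (bernstein_ext n _ (fun x => c * (u x * v x))%C) by (intros; ring).
  rewrite bernstein_scal. ring.
Qed.

Lemma remainder_plus (n : nat) (z : C) (u1 u2 v : R -> C) (u1' u2' v' : C) :
  remainder n z (fun x => (u1 x + u2 x)%C) (u1' + u2')%C v v'
  = (remainder n z u1 u1' v v' + remainder n z u2 u2' v v')%C.
Proof.
  unfold remainder, Cdiv. rewrite bernstein_plus.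
  rewrite (bernstein_ext n _ (fun x => u1 x * v x + u2 x * v x)%C) by (intros; ring).
  rewrite bernstein_plus. ring.
Qed.

Lemma remainder_ext (n : nat) (z : C) (u1 u2 v : R -> C) (u' v' : C) :
  (forall x, u1 x = u2 x) -> remainder n z u1 u' v v' = remainder n z u2 u' v v'.
Proof.
  intros H. unfold remainder. rewrite (bernstein_ext n u1 u2) by exact H.
  rewrite (bernstein_ext n _ (fun x => u2 x * v x)%C); [reflexivity|].
  intros x; now rewrite H.
Qed.

Lemma remainder_sum (n : nat) (z : C) (a : nat -> C) (u : nat -> R -> C) (u' : nat -> C)
  (v : R -> C) (v' : C) (N : nat) :
  remainder n z (fun x => sum_n (fun i => (a i * u i x)%C) N)
    (sum_n (fun i => (a i * u' i)%C) N) v v'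
  = sum_n (fun i => (a i * remainder n z (u i) (u' i) v v')%C) N.
Proof.
  induction N as [|N IH].
  - rewrite !sum_O, <- remainder_scal. apply remainder_ext. intros x. apply sum_O.
  - rewrite !sum_n_CS, <- IH, <- remainder_scal, <- remainder_plus.
    apply remainder_ext. intros x. apply sum_n_CS.
Qed.

(** The bound on pairs has separated weights [p i * q j], so the double sum given by bilinearity
    factors into two single sums, which can be bounded independently of [N]. *)
Lemma remainder_sum_bound (n : nat) (z : C) (a b : nat -> C) (u v : nat -> R -> C)
  (u' v' : nat -> C) (p q : nat -> R) (M : R) (N : nat) :
  (forall i j, Cmod (remainder n z (u i) (u' i) (v j) (v' j)) <= M * p i * q j) ->
  Cmod (remainder n z
     (fun x => sum_n (fun i => (a i * u i x)%C) N) (sum_n (fun i => (a i * u' i)%C) N)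
     (fun x => sum_n (fun j => (b j * v j x)%C) N) (sum_n (fun j => (b j * v' j)%C) N))
  <= M * sum_n (fun i => Cmod (a i) * p i) N * sum_n (fun j => Cmod (b j) * q j) N.
Proof.
  intros H. rewrite remainder_sum.
  eapply Rle_trans; [apply Cmod_sum_n|].
  set (A := sum_n (fun i => Cmod (a i) * p i) N).
  set (B := sum_n (fun j => Cmod (b j) * q j) N).
  replace (M * A * B) with (M * B * A) by ring.
  replace (M * B * A) with (sum_n (fun i => (M * B) * (Cmod (a i) * p i)) N)
    by exact (sum_n_mult_l (K := R_Ring) (M * B) _ N).
  apply sum_n_m_le; intros i. rewrite Cmod_mult.
  replace (M * B * (Cmod (a i) * p i)) with (Cmod (a i) * (M * p i * B)) by ring.
  apply Rmult_le_compat_l; [apply Cmod_ge_0|].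
  (* The first pair is now a single function; swapping the pairs exposes the sum over [j]. *)
  rewrite remainder_sym, remainder_sum.
  eapply Rle_trans; [apply Cmod_sum_n|].
  replace (M * p i * B) with (sum_n (fun j => (M * p i) * (Cmod (b j) * q j)) N)
    by exact (sum_n_mult_l (K := R_Ring) (M * p i) _ N).
  apply sum_n_m_le; intros j. rewrite Cmod_mult, remainder_sym.
  replace (M * p i * (Cmod (b j) * q j)) with (Cmod (b j) * (M * p i * q j)) by ring.
  apply Rmult_le_compat_l; [apply Cmod_ge_0 | apply H].
Qed.

(** * The remainder on pairs of monomials *)

Definition voronovskaya (n : nat) (z : C) (m : nat) : C :=
  (RtoC (collisions m 0 / INR n) * (z ^ pred m - z ^ m))%C.

(** Since [collisions m 0] is [m(m-1)/2], [voronovskaya n z m] is the classical term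
    [z(1-z)(z^m)''/(2n)]. The identity is the Leibniz rule [(uv)'' = u''v + uv'' + 2u'v'], whose
    cross term is the one subtracted in the theorem. *)
Lemma voronovskaya_add (n : nat) (z : C) (i j : nat) :
  (1 <= n)%nat ->
  voronovskaya n z (i + j)
  = (z ^ j * voronovskaya n z i + z ^ i * voronovskaya n z j
     + z * (1 - z) * (RtoC (INR i) * z ^ pred i) * (RtoC (INR j) * z ^ pred j)
       / RtoC (INR n))%C.
Proof.
  intros Hn. assert (Hn0 : INR n <> 0) by (apply not_0_INR; lia).
  unfold voronovskaya. unfold Cdiv. rewrite <- RtoC_inv by exact Hn0.
  assert (E : collisions (i + j) 0 / INR n
     = collisions i 0 / INR n + collisions j 0 / INR n + INR i * INR j * / INR n).
  { unfold collisions. rewrite plus_INR. simpl (INR 0). field. exact Hn0. }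
  (* Zero exponents are split off because of the truncated [pred]; their coefficients vanish. *)
  destruct i as [|i].
  { replace (collisions 0 0) with 0 by (unfold collisions; simpl; field).
    replace (0 / INR n) with 0 by (field; exact Hn0). simpl Nat.add. simpl INR. simpl Cpow. ring. }
  destruct j as [|j].
  { replace (collisions 0 0) with 0 by (unfold collisions; simpl; field).
    replace (0 / INR n) with 0 by (field; exact Hn0). rewrite Nat.add_0_r.
    simpl (INR 0). simpl (z ^ 0)%C. ring. }
  rewrite E, !RtoC_plus, !RtoC_mult.
  replace (pred (S i + S j)) with (S (i + j)) by lia.
  replace (S i + S j)%nat with (S (S (i + j))) by lia. simpl pred.
  rewrite !Cpow_S, Cpow_add_r. ring.
Qed.

Lemma bernstein_pow_expansion (n : nat) (z : C) (m : nat) :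
  bernstein n (fun x => (RtoC x ^ m)%C) z
  = (z ^ m + voronovskaya n z m + moment_error z n 0 m)%C.
Proof.
  rewrite bernstein_pow. unfold moment_error, voronovskaya. rewrite !Nat.add_0_r. ring.
Qed.

(** The coefficient grows only quadratically in [m]; the exponent is raised to 4 so that this term
    and [moment_error] share the weight [(m + 1)^4 r^m]. *)
Lemma voronovskaya_bound (n : nat) (z : C) (r : R) (m : nat) :
  (1 <= n)%nat -> 1 <= r -> Cmod z <= r ->
  Cmod (voronovskaya n z m) <= 2 * (INR m + 1) ^ 4 * r ^ m / INR n.
Proof.
  intros Hn Hr Hz. assert (Hn0 : 0 < INR n) by (apply lt_0_INR; lia).
  pose proof (pos_INR m) as Hm.
  destruct (collisions_bounds m 0) as [H0 H1]. simpl (INR 0) in H1. rewrite Rplus_0_r in H1.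
  unfold voronovskaya. rewrite Cmod_RtoC_mult by (apply Rle_div_r; lra).
  replace (2 * (INR m + 1) ^ 4 * r ^ m / INR n)
    with ((INR m + 1) ^ 4 / INR n * (2 * r ^ m)) by (field; lra).
  apply Rmult_le_compat; [apply Rle_div_r; lra | apply Cmod_ge_0 | |].
  - apply Rmult_le_compat_r; [left; now apply Rinv_0_lt_compat|].
    apply Rle_trans with (1 := H1).
    apply Rle_trans with ((INR m + 1) ^ 2); [apply pow_incr; lra | apply Rle_pow; lra || lia].
  - eapply Rle_trans; [apply Cmod_triangle_minus|].
    assert (Cmod (z ^ pred m)%C <= r ^ m) by (apply Cmod_pow_le; auto; lia).
    assert (Cmod (z ^ m)%C <= r ^ m) by (apply Cmod_pow_le; auto; lia). lra.
Qed.

Lemma moment_error_bound0 (n : nat) (z : C) (r : R) (m : nat) :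
  (1 <= n)%nat -> 1 <= r -> Cmod z <= r ->
  Cmod (moment_error z n 0 m) <= 4 * INR m ^ 4 * r ^ m / INR n ^ 2.
Proof.
  intros Hn Hr Hz.
  eapply Rle_trans; [apply (moment_error_bound z r m n 0); auto; lia|].
  rewrite !Nat.add_0_r. right. field. apply not_0_INR; lia.
Qed.

Lemma remainder_pow_bound (n : nat) (z : C) (r : R) (i j : nat) :
  (1 <= n)%nat -> 1 <= r -> Cmod z <= r ->
  Cmod (remainder n z (fun x => (RtoC x ^ i)%C) (RtoC (INR i) * z ^ pred i)%C
                      (fun x => (RtoC x ^ j)%C) (RtoC (INR j) * z ^ pred j)%C)
  <= 48 / INR n ^ 2 * ((INR i + 1) ^ 4 * r ^ i) * ((INR j + 1) ^ 4 * r ^ j).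
Proof.
  intros Hn Hr Hz.
  unfold remainder.
  rewrite (bernstein_ext n _ (fun x => RtoC x ^ (i + j))%C)
    by (intros x; now rewrite Cpow_add_r).
  rewrite !bernstein_pow_expansion, voronovskaya_add by exact Hn.
  rewrite Cpow_add_r.
  (* The terms of order 1 and [1 / n] cancel, leaving errors and one product of two quantities of
     order [1 / n]. *)
  match goal with |- Cmod ?x <= _ => replace x with
    (moment_error z n 0 (i + j) - z ^ i * moment_error z n 0 j
     - z ^ j * moment_error z n 0 i
     - (voronovskaya n z i + moment_error z n 0 i)
       * (voronovskaya n z j + moment_error z n 0 j))%C by (unfold Cdiv; ring) end.
  assert (Hn1 : 1 <= INR n) by (change 1 with (INR 1); apply le_INR; exact Hn).
  set (x := / INR n).
  assert (Hx : 0 < x <= 1).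
  { unfold x. split; [apply Rinv_0_lt_compat; lra|].
    rewrite <- Rinv_1. apply Rinv_le_contravar; lra. }
  assert (Hweak : forall m, INR m ^ 4 <= (INR m + 1) ^ 4)
    by (intros m; pose proof (pos_INR m); apply pow_incr; lra).
  assert (HE : forall m, Cmod (moment_error z n 0 m) <= 4 * ((INR m + 1) ^ 4 * r ^ m) * x ^ 2).
  { intros m. eapply Rle_trans; [apply (moment_error_bound0 n z r m); auto|].
    unfold x. rewrite pow_inv. unfold Rdiv. rewrite <- Rmult_assoc.
    apply Rmult_le_compat_r; [left; apply Rinv_0_lt_compat, pow_lt; lra|].
    apply Rmult_le_compat_r; [apply pow_le; lra|].
    specialize (Hweak m); lra. }
  (* Here [6 = 2 + 4], because [x ^ 2 <= x]. *)
  assert (HV : forall m, Cmod (voronovskaya n z m + moment_error z n 0 m)%C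
                         <= 6 * ((INR m + 1) ^ 4 * r ^ m) * x).
  { intros m. eapply Rle_trans; [apply Cmod_triangle|].
    pose proof (voronovskaya_bound n z r m Hn Hr Hz) as H1. unfold Rdiv in H1. fold x in H1.
    specialize (HE m).
    assert (0 <= (INR m + 1) ^ 4 * r ^ m).
    { apply Rmult_le_pos; apply pow_le; [pose proof (pos_INR m)|]; lra. }
    assert (x ^ 2 <= x) by nra.
    assert ((INR m + 1) ^ 4 * r ^ m * x ^ 2 <= (INR m + 1) ^ 4 * r ^ m * x)
      by (apply Rmult_le_compat_l; auto).
    nra. }
  assert (HP : forall m, 1 <= (INR m + 1) ^ 4 /\ 0 < r ^ m).
  { intros m. split; [apply pow_R1_Rle; pose proof (pos_INR m) | apply pow_lt]; lra. }
  (* The weight is submultiplicative, as [i + j <= (i + 1) * (j + 1)]. *)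
  assert (HEij : Cmod (moment_error z n 0 (i + j))
     <= 4 * ((INR i + 1) ^ 4 * r ^ i) * ((INR j + 1) ^ 4 * r ^ j) * x ^ 2).
  { eapply Rle_trans; [apply (moment_error_bound0 n z r (i + j)); auto|].
    unfold x. rewrite pow_inv. unfold Rdiv.
    apply Rmult_le_compat_r; [left; apply Rinv_0_lt_compat, pow_lt; lra|].
    rewrite pow_add.
    replace (4 * ((INR i + 1) ^ 4 * r ^ i) * ((INR j + 1) ^ 4 * r ^ j))
      with (4 * ((INR i + 1) * (INR j + 1)) ^ 4 * (r ^ i * r ^ j)) by ring.
    apply Rmult_le_compat_r; [apply Rmult_le_pos; apply pow_le; lra|].
    apply Rmult_le_compat_l; [lra|]. rewrite plus_INR.
    pose proof (pos_INR i). pose proof (pos_INR j). apply pow_incr. nra. }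
  set (P := (INR i + 1) ^ 4 * r ^ i) in *.
  set (Q := (INR j + 1) ^ 4 * r ^ j) in *.
  assert (HPi : r ^ i <= P /\ 0 <= P) by (unfold P; destruct (HP i); nra).
  assert (HQj : r ^ j <= Q /\ 0 <= Q) by (unfold Q; destruct (HP j); nra).
  assert (Hij : Cmod (z ^ i * moment_error z n 0 j)%C <= P * (4 * Q * x ^ 2)).
  { rewrite Cmod_mult. apply Rmult_le_compat; try apply Cmod_ge_0; [|apply HE].
    apply Rle_trans with (r ^ i); [apply Cmod_pow_le; auto | apply HPi]. }
  assert (Hji : Cmod (z ^ j * moment_error z n 0 i)%C <= Q * (4 * P * x ^ 2)).
  { rewrite Cmod_mult. apply Rmult_le_compat; try apply Cmod_ge_0; [|apply HE].
    apply Rle_trans with (r ^ j); [apply Cmod_pow_le; auto | apply HQj]. }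
  assert (HVV : Cmod ((voronovskaya n z i + moment_error z n 0 i)
       * (voronovskaya n z j + moment_error z n 0 j))%C <= (6 * P * x) * (6 * Q * x)).
  { rewrite Cmod_mult. apply Rmult_le_compat; try apply Cmod_ge_0; apply HV. }
  replace (48 / INR n ^ 2) with (48 * x ^ 2) by (unfold x; rewrite pow_inv; reflexivity).
  eapply Rle_trans; [apply Cmod_triangle_minus|].
  eapply Rle_trans; [apply Rplus_le_compat_r, Cmod_triangle_minus|].
  eapply Rle_trans; [apply Rplus_le_compat_r, Rplus_le_compat_r, Cmod_triangle_minus|].
  (* The constant is [48 = 4 + 4 + 4 + 6 * 6]. *)
  lra.
Qed.

(** * Limits and weighted power series *)

(* [C] carries two uniform structures in Coquelicot (product and modulus), so
   limits are phrased directly with [Cmod]. *)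
Definition Ccv (u : nat -> C) (l : C) : Prop :=
  is_lim_seq (fun N => Cmod (u N - l)%C) 0.

Lemma Ccv_majorized (u : nat -> C) (l : C) (v : nat -> R) :
  (forall N, Cmod (u N - l)%C <= v N) -> is_lim_seq v 0 -> Ccv u l.
Proof.
  intros H Hv. apply (is_lim_seq_le_le (fun _ => 0) _ v); [|apply is_lim_seq_const|exact Hv].
  intros N. split; [apply Cmod_ge_0 | apply H].
Qed.

Lemma Ccv_const (c : C) : Ccv (fun _ => c) c.
Proof.
  apply (Ccv_majorized _ _ (fun _ => 0)); [|apply is_lim_seq_const].
  intros _. replace (c - c)%C with (RtoC 0) by ring. rewrite Cmod_0. lra.
Qed.

Lemma Ccv_plus (u v : nat -> C) (l m : C) :
  Ccv u l -> Ccv v m -> Ccv (fun N => (u N + v N)%C) (l + m)%C.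
Proof.
  intros Hu Hv. apply (Ccv_majorized _ _ (fun N => Cmod (u N - l)%C + Cmod (v N - m)%C)).
  - intros N. replace (u N + v N - (l + m))%C with ((u N - l) + (v N - m))%C by ring.
    apply Cmod_triangle.
  - replace (Finite 0) with (Finite (0 + 0)) by (f_equal; ring).
    now apply is_lim_seq_plus'.
Qed.

Lemma Ccv_mult (u v : nat -> C) (l m : C) :
  Ccv u l -> Ccv v m -> Ccv (fun N => (u N * v N)%C) (l * m)%C.
Proof.
  intros Hu Hv.
  apply (Ccv_majorized _ _ (fun N => Cmod (u N - l)%C * Cmod (v N - m)%C
     + (Cmod l * Cmod (v N - m)%C + Cmod m * Cmod (u N - l)%C))).
  - intros N.
    replace (u N * v N - l * m)%C
      with ((u N - l) * (v N - m) + (l * (v N - m) + m * (u N - l)))%C by ring.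
    rewrite <- !Cmod_mult.
    eapply Rle_trans; [apply Cmod_triangle|]. apply Rplus_le_compat_l, Cmod_triangle.
  - replace (Finite 0) with (Finite (0 * 0 + (Cmod l * 0 + Cmod m * 0))) by (f_equal; ring).
    repeat first [apply is_lim_seq_plus' | apply is_lim_seq_mult']; try exact Hu; try exact Hv;
      apply is_lim_seq_const.
Qed.

Lemma Ccv_minus (u v : nat -> C) (l m : C) :
  Ccv u l -> Ccv v m -> Ccv (fun N => (u N - v N)%C) (l - m)%C.
Proof.
  intros Hu Hv. apply Ccv_plus; [exact Hu|].
  apply (Ccv_majorized _ _ (fun N => Cmod (v N - m)%C)); [|exact Hv].
  intros N. rewrite <- Cmod_opp. right. f_equal. ring.
Qed.

Lemma Ccv_sum_n (u : nat -> nat -> C) (l : nat -> C) (n : nat) :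
  (forall k, (k <= n)%nat -> Ccv (fun N => u N k) (l k)) ->
  Ccv (fun N => sum_n (u N) n) (sum_n l n).
Proof.
  unfold Ccv. induction n as [|n IH]; intros H.
  - eapply is_lim_seq_ext; [|apply (H O); lia]. intros N. simpl. now rewrite !sum_O.
  - eapply is_lim_seq_ext; [|apply (Ccv_plus _ _ _ _ (IH (fun k Hk => H k ltac:(lia))) (H (S n) ltac:(lia)))].
    intros N. simpl. now rewrite !sum_n_CS.
Qed.

Lemma Ccv_bound (u : nat -> C) (l : C) (K : R) :
  Ccv u l -> (forall N, Cmod (u N) <= K) -> Cmod l <= K.
Proof.
  intros Hu HK.
  assert (H : Rbar_le (Cmod l) (0 + K)).
  { apply (is_lim_seq_le (fun _ => Cmod l) (fun N => Cmod (u N - l)%C + K)).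
    - intros N. replace l with (u N - (u N - l))%C at 1 by ring.
      eapply Rle_trans; [apply Cmod_triangle_minus|]. specialize (HK N). lra.
    - apply is_lim_seq_const.
    - apply is_lim_seq_plus'; [exact Hu | apply is_lim_seq_const]. }
  simpl in H. lra.
Qed.

Lemma is_series_Ccv (c : nat -> C) (l : C) :
  @is_series C_AbsRing C_NormedModule c l -> Ccv (sum_n c) l.
Proof.
  intros H. unfold Ccv.
  assert (H0 : filterlim (fun N => plus (sum_n c N) (opp l)) eventually
                 (locally (@plus C_NormedModule l (opp l)))).
  { eapply filterlim_comp_2; [exact H | apply filterlim_const | apply (filterlim_plus (V := C_NormedModule))]. }
  assert (H' := filterlim_comp _ _ _ _ _ _ _ _ H0 (filterlim_norm (V := C_NormedModule) _)).
  rewrite (plus_opp_r (G := C_NormedModule)) in H'.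
  change (filterlim (fun N => Cmod (sum_n c N - l)%C) eventually (locally (Cmod (RtoC 0)))) in H'.
  rewrite Cmod_0 in H'. exact H'.
Qed.

(** Differentiating the geometric series four times keeps the radius of convergence 1 and produces
    the coefficients [(k+1)(k+2)(k+3)(k+4)], which dominate [(k+1)^4]. *)
Lemma ex_series_poly_geom (q : R) :
  0 <= q < 1 -> ex_series (fun k => (INR k + 1) ^ 4 * q ^ k).
Proof.
  intros Hq.
  assert (Hr : CV_radius (PS_derive (PS_derive (PS_derive (PS_derive (fun _ => 1))))) = 1).
  { rewrite !CV_radius_derive, (CV_radius_finite_DAlembert _ 1); try lra.
    - f_equal. lra.
    - intros _. lra.
    - apply (is_lim_seq_ext (fun _ => 1)); [|apply is_lim_seq_const].
      intros n. replace (1 / 1) with 1 by field. rewrite Rabs_pos_eq; lra. }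
  assert (Hs := CV_disk_inside (PS_derive (PS_derive (PS_derive (PS_derive (fun _ => 1))))) q).
  rewrite Hr in Hs. simpl Rbar_lt in Hs. rewrite Rabs_pos_eq in Hs by lra.
  eapply (ex_series_le (V := R_CompleteNormedModule)); [|exact (Hs (proj2 Hq))].
  intros k. simpl. pose proof (pos_INR k).
  assert (0 <= q ^ k) by (apply pow_le; lra).
  assert (0 <= (INR k + 1) ^ 4) by (apply pow_le; lra).
  change (norm ((INR k + 1) ^ 4 * q ^ k)) with (Rabs ((INR k + 1) ^ 4 * q ^ k)).
  unfold PS_derive. rewrite !S_INR.
  replace (INR k + 1 + 1) with (INR k + 2) by ring.
  replace (INR k + 2 + 1) with (INR k + 3) by ring.
  replace (INR k + 3 + 1) with (INR k + 4) by ring.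
  assert (Hp : (INR k + 1) ^ 4 <= (INR k + 1) * ((INR k + 2) * ((INR k + 3) * ((INR k + 4) * 1)))).
  { replace ((INR k + 1) ^ 4) with ((INR k + 1) * ((INR k + 1) * ((INR k + 1) * ((INR k + 1) * 1)))) by ring.
    repeat (apply Rmult_le_compat; try lra; repeat (apply Rmult_le_pos; try lra)). }
  rewrite !Rabs_pos_eq by (apply Rmult_le_pos; lra).
  apply Rmult_le_compat_r; lra.
Qed.

Lemma is_series_terms_bounded (c : nat -> C) (l : C) :
  @is_series C_AbsRing C_NormedModule c l -> exists M, forall k, Cmod (c k) <= M.
Proof.
  intros H.
  destruct (filterlim_bounded (V := C_NormedModule) (sum_n c) (ex_intro _ l H)) as [M HM].
  exists (2 * M). assert (HM' : forall n, Cmod (sum_n c n) <= M) by exact HM.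
  intros [|k].
  - specialize (HM' O). rewrite sum_O in HM'.
    pose proof (Cmod_ge_0 (c O)). lra.
  - replace (c (S k)) with (sum_n c (S k) - sum_n c k)%C
      by (rewrite sum_n_CS; cring).
    eapply Rle_trans; [apply Cmod_triangle_minus|].
    pose proof (HM' k). pose proof (HM' (S k)). lra.
Qed.

(** At a radius [rho] strictly between [r] and [R0] the terms [a k * rho ^ k] are bounded by some
    [M], and the factor [(r / rho) ^ k] then absorbs the polynomial weight. *)
Lemma power_series_weighted_summable (R0 r : R) (f : C -> C) (a : nat -> C) :
  0 <= r < R0 ->
  (forall z : C, Cmod z < R0 -> is_series (fun k : nat => (a k * pow_n z k)%C) (f z)) ->
  ex_series (fun k => Cmod (a k) * ((INR k + 1) ^ 4 * r ^ k)).
Proof.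
  intros Hr Hf. set (rho := (r + R0) / 2).
  assert (Hrho : 0 < rho /\ r < rho /\ rho < R0) by (unfold rho; lra).
  assert (Hc : Cmod (RtoC rho) < R0) by (rewrite Cmod_R, Rabs_pos_eq; lra).
  destruct (is_series_terms_bounded _ _ (Hf _ Hc)) as [M HM].
  apply (ex_series_le (V := R_CompleteNormedModule) _ (fun k => M * ((INR k + 1) ^ 4 * (r / rho) ^ k))).
  - intros k. specialize (HM k).
    rewrite pow_n_Cpow, Cmod_mult, Cmod_pow, Cmod_R, Rabs_pos_eq in HM by lra.
    assert (Hk : 0 < rho ^ k) by (apply pow_lt; lra).
    assert (Hw : 0 <= (INR k + 1) ^ 4 * (r / rho) ^ k).
    { apply Rmult_le_pos; apply pow_le; [pose proof (pos_INR k); lra|].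
      apply Rle_div_r; lra. }
    replace (Cmod (a k) * ((INR k + 1) ^ 4 * r ^ k))
      with (Cmod (a k) * rho ^ k * ((INR k + 1) ^ 4 * (r / rho) ^ k)).
    2:{ unfold Rdiv at 1. rewrite Rpow_mult_distr, pow_inv. field. lra. }
    change (Rabs (Cmod (a k) * rho ^ k * ((INR k + 1) ^ 4 * (r / rho) ^ k))
            <= M * ((INR k + 1) ^ 4 * (r / rho) ^ k)).
    rewrite Rabs_pos_eq.
    + now apply Rmult_le_compat_r.
    + apply Rmult_le_pos; [|exact Hw]. apply Rmult_le_pos; [apply Cmod_ge_0 | lra].
  - apply (ex_series_scal (V := R_NormedModule) M), ex_series_poly_geom.
    split; [apply Rle_div_r | apply Rlt_div_l]; lra.
Qed.

Lemma ex_series_sum_bounded (c : nat -> R) :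
  ex_series c -> exists A, forall N, Rabs (sum_n c N) <= A.
Proof.
  intros H. destruct (filterlim_bounded (V := R_NormedModule) (sum_n c) H) as [A HA].
  exists A. exact HA.
Qed.

(** * Termwise differentiation *)

(** The remainder for [k + 1] is [w] times that for [k] plus [k z^(k-1) (w-z)^2], and
    [k^2 + k <= (k+1)^2]. *)
Lemma Cpow_taylor_bound (w z : C) (r : R) (k : nat) :
  1 <= r -> Cmod w <= r -> Cmod z <= r ->
  Cmod (w ^ k - z ^ k - RtoC (INR k) * z ^ pred k * (w - z))%C
  <= INR k ^ 2 * r ^ k * Cmod (w - z)%C ^ 2.
Proof.
  intros Hr Hw Hz. induction k as [|k IH].
  { simpl. match goal with |- Cmod ?x <= _ => replace x with (RtoC 0) by ring end.
    rewrite Cmod_0. lra. }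
  replace (w ^ S k - z ^ S k - RtoC (INR (S k)) * z ^ pred (S k) * (w - z))%C
    with (w * (w ^ k - z ^ k - RtoC (INR k) * z ^ pred k * (w - z))
          + RtoC (INR k) * (z ^ pred k * ((w - z) * (w - z))))%C.
  2:{ rewrite S_INR, RtoC_plus. destruct k as [|k]; simpl pred; rewrite !Cpow_S; [simpl|]; ring. }
  eapply Rle_trans; [apply Cmod_triangle|].
  rewrite Cmod_RtoC_mult by apply pos_INR. rewrite !Cmod_mult.
  set (d := Cmod (w - z)%C) in *. assert (Hd : 0 <= d) by apply Cmod_ge_0.
  assert (H1 : Cmod w * Cmod (w ^ k - z ^ k - RtoC (INR k) * z ^ pred k * (w - z))%C
    <= r * (INR k ^ 2 * r ^ k * d ^ 2)).
  { apply Rmult_le_compat; auto; apply Cmod_ge_0. }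
  assert (H2 : Cmod (z ^ pred k)%C <= r ^ S k) by (apply Cmod_pow_le; auto; lia).
  pose proof (pos_INR k). rewrite S_INR.
  assert (H3 : INR k * (Cmod (z ^ pred k)%C * (d * d)) <= INR k * (r ^ S k * (d * d))).
  { apply Rmult_le_compat_l; [lra|]. apply Rmult_le_compat_r; [nra|exact H2]. }
  simpl pow in *.
  assert (0 <= r * r ^ k * (d * d)).
  { repeat apply Rmult_le_pos; try lra. apply pow_le; lra. }
  nra.
Qed.

(** A quadratic remainder makes the difference quotient tend to [l]; uniqueness of the limit
    identifies the total function [C_derive]. *)
Lemma C_derive_intro (f : C -> C) (z l : C) (delta A : R) :
  0 < delta ->
  (forall w, Cmod (w - z)%C < delta ->
     Cmod (f w - f z - l * (w - z))%C <= A * Cmod (w - z)%C ^ 2) ->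
  C_derive f z = l.
Proof.
  intros Hd H. apply is_C_lim_unique, filterlim_locally. intros eps.
  set (B := Rabs A + 1). pose proof (cond_pos eps) as He.
  assert (HB : 0 < B /\ A <= B) by (unfold B; pose proof (Rle_abs A); pose proof (Rabs_pos A); lra).
  (* The halves compensate the factor [sqrt 2 < 2] lost when passing from a ball of the product
     structure to the modulus. *)
  assert (Hd' : 0 < Rmin (delta / 2) (eps / B / 2)).
  { apply Rmin_glb_lt; [lra|]. assert (0 < eps / B) by (apply Rlt_div_r; lra). lra. }
  exists (mkposreal _ Hd'). intros w Hw Hne.
  apply C_NormedModule_mixin_compat1.
  apply (C_NormedModule_mixin_compat2 z w) in Hw. simpl pos in Hw.
  change (Cmod (w - z)%C < sqrt 2 * Rmin (delta / 2) (eps / B / 2)) in Hw.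
  change (Cmod ((f w - f z) / (w - z) - l)%C < eps).
  assert (Hs : sqrt 2 < 2).
  { replace 2 with (sqrt (2 * 2)) at 2 by (apply sqrt_square; lra). apply sqrt_lt_1; lra. }
  assert (Hw1 : Cmod (w - z)%C < 2 * Rmin (delta / 2) (eps / B / 2)).
  { eapply Rlt_trans; [exact Hw|]. now apply Rmult_lt_compat_r. }
  pose proof (Rmin_l (delta / 2) (eps / B / 2)). pose proof (Rmin_r (delta / 2) (eps / B / 2)).
  assert (Hwz : (w - z)%C <> RtoC 0).
  { intros E. apply Hne. replace w with (w - z + z)%C by ring. rewrite E. cring. }
  assert (Hpos : 0 < Cmod (w - z)%C) by now apply Cmod_gt_0.
  replace ((f w - f z) / (w - z) - l)%C with ((f w - f z - l * (w - z)) / (w - z))%C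
    by (field; exact Hwz).
  rewrite Cmod_div by exact Hwz.
  apply Rlt_div_l; [exact Hpos|].
  eapply Rle_lt_trans; [apply H; lra|].
  replace (A * Cmod (w - z)%C ^ 2) with (A * Cmod (w - z)%C * Cmod (w - z)%C) by ring.
  apply Rmult_lt_compat_r; [exact Hpos|].
  apply Rle_lt_trans with (B * Cmod (w - z)%C).
  { apply Rmult_le_compat_r; lra. }
  rewrite Rmult_comm. apply Rlt_div_r; lra.
Qed.

(** A radius [s] strictly between [r] and [R0] leaves room for all [w] within [s - r] of [z].
    Summing the Taylor bounds of the monomials gives a quadratic remainder with constant [A],
    uniform in [N], and it survives in the limit. *)
Lemma power_series_C_derive (R0 r : R) (f : C -> C) (a : nat -> C) (z : C) :
  1 <= r -> r < R0 -> Cmod z <= r ->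
  (forall z : C, Cmod z < R0 -> is_series (fun k : nat => (a k * pow_n z k)%C) (f z)) ->
  Ccv (sum_n (fun k => (a k * (RtoC (INR k) * z ^ pred k))%C)) (C_derive f z).
Proof.
  intros Hr Hr0 Hz Hf. set (s := (r + R0) / 2).
  assert (Hs : r < s < R0) by (unfold s; lra).
  assert (Hsum := power_series_weighted_summable R0 s f a ltac:(lra) Hf).
  assert (Hdom : forall k, INR k * s ^ k <= (INR k + 1) ^ 4 * s ^ k
                           /\ INR k ^ 2 * s ^ k <= (INR k + 1) ^ 4 * s ^ k).
  { intros k. pose proof (pos_INR k).
    assert (1 <= (INR k + 1) ^ 2) by (apply pow_R1_Rle; lra).
    split; (apply Rmult_le_compat_r; [apply pow_le; lra|]);
      replace ((INR k + 1) ^ 4) with ((INR k + 1) ^ 2 * (INR k + 1) ^ 2) by ring; nra. }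
  assert (Hl : ex_series (V := C_NormedModule) (fun k => (a k * (RtoC (INR k) * z ^ pred k))%C)).
  { eapply (ex_series_le (V := C_CompleteNormedModule)); [|exact Hsum].
    intros k. change (Cmod (a k * (RtoC (INR k) * z ^ pred k))%C
                      <= Cmod (a k) * ((INR k + 1) ^ 4 * s ^ k)).
    rewrite Cmod_mult. apply Rmult_le_compat_l; [apply Cmod_ge_0|].
    rewrite Cmod_RtoC_mult by apply pos_INR.
    apply Rle_trans with (INR k * s ^ k); [|apply Hdom].
    apply Rmult_le_compat_l; [apply pos_INR|]. apply Cmod_pow_le; lra || lia. }
  destruct Hl as [l Hl]. apply is_series_Ccv in Hl.
  destruct (ex_series_sum_bounded _ Hsum) as [A HA].
  replace (C_derive f z) with l; [exact Hl|]. symmetry.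
  apply (C_derive_intro f z l (s - r) A); [lra|].
  intros w Hw.
  assert (Hws : Cmod w <= s).
  { replace w with ((w - z) + z)%C by ring.
    eapply Rle_trans; [apply Cmod_triangle|]. lra. }
  assert (Hfw := is_series_Ccv _ _ (Hf w ltac:(lra))).
  assert (Hfz := is_series_Ccv _ _ (Hf z ltac:(lra))).
  eapply Ccv_bound.
  { apply Ccv_minus; [apply Ccv_minus; [exact Hfw | exact Hfz]|].
    apply Ccv_mult; [exact Hl | apply Ccv_const]. }
  intros N. set (d := Cmod (w - z)%C).
  apply Rle_trans with (Cmod
   (sum_n (fun k => (a k * (w ^ k - z ^ k - RtoC (INR k) * z ^ pred k * (w - z)))%C) N)).
  { right. apply (f_equal Cmod). rewrite (sum_n_ext (fun k => (a k * pow_n w k)%C) (fun k => (a k * w ^ k)%C))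
        by (intros k; now rewrite pow_n_Cpow).
      rewrite (sum_n_ext (fun k => (a k * pow_n z k)%C) (fun k => (a k * z ^ k)%C))
        by (intros k; now rewrite pow_n_Cpow).
      clear. induction N as [|N IH].
      - rewrite !sum_O. cring.
      - rewrite !sum_n_CS, <- IH. cring. }
  eapply Rle_trans; [apply Cmod_sum_n|].
  apply Rle_trans with (sum_n (fun k => d ^ 2 * (Cmod (a k) * ((INR k + 1) ^ 4 * s ^ k))) N).
  { apply sum_n_m_le. intros k. rewrite Cmod_mult.
    replace (d ^ 2 * (Cmod (a k) * ((INR k + 1) ^ 4 * s ^ k)))
      with (Cmod (a k) * ((INR k + 1) ^ 4 * s ^ k * d ^ 2)) by ring.
    apply Rmult_le_compat_l; [apply Cmod_ge_0|].
    eapply Rle_trans; [apply (Cpow_taylor_bound w z s); lra|]. fold d.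
    apply Rmult_le_compat_r; [apply pow2_ge_0 | apply Hdom]. }
  eapply Rle_trans; [right; apply (sum_n_mult_l (K := R_Ring))|].
  change (d ^ 2 * sum_n (fun k => Cmod (a k) * ((INR k + 1) ^ 4 * s ^ k)) N <= A * d ^ 2).
  rewrite (Rmult_comm A). apply Rmult_le_compat_l; [apply pow2_ge_0|].
  eapply Rle_trans; [apply Rle_abs | apply HA].
Qed.

(** * From partial sums to analytic functions *)

Lemma bernstein_Ccv (n : nat) (u : nat -> R -> C) (h : R -> C) (z : C) :
  (1 <= n)%nat -> (forall x, 0 <= x <= 1 -> Ccv (fun N => u N x) (h x)) ->
  Ccv (fun N => bernstein n (u N) z) (bernstein n h z).
Proof.
  intros Hn H. apply (Ccv_sum_n (fun N k => _)). intros k Hk.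
  apply Ccv_mult; [apply Ccv_const|]. apply H.
  assert (0 < INR n) by (apply lt_0_INR; lia). pose proof (pos_INR k).
  pose proof (le_INR _ _ Hk).
  split; [apply Rle_div_r | apply Rle_div_l]; lra.
Qed.

Theorem theorem4p2 :
  forall (R0 r : R) (f g : C -> C) (a b : nat -> C),
    1 <= r -> r < R0 ->
    (forall z : C, Cmod z < R0 ->
       is_series (fun k : nat => (a k * pow_n z k)%C) (f z)) ->
    (forall z : C, Cmod z < R0 ->
       is_series (fun k : nat => (b k * pow_n z k)%C) (g z)) ->
    exists K : R, forall (n : nat) (z : C),
      (1 <= n)%nat -> Cmod z <= r ->
      Cmod (bernstein n (fun x : R => (f (RtoC x) * g (RtoC x))%C) z
            - bernstein n (fun x : R => f (RtoC x)) z
              * bernstein n (fun x : R => g (RtoC x)) z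
            - z * (1 - z) * C_derive f z * C_derive g z / RtoC (INR n))%C
      <= K / (INR n) ^ 2.
Proof.
  intros R0 r f g a b Hr Hr0 Hf Hg.
  destruct (ex_series_sum_bounded _
    (power_series_weighted_summable R0 r f a ltac:(lra) Hf)) as [A HA].
  destruct (ex_series_sum_bounded _
    (power_series_weighted_summable R0 r g b ltac:(lra) Hg)) as [B HB].
  (* [A] and [B] bound all weighted partial sums of the coefficients, and 48 comes from the monomial
     estimate. *)
  exists (48 * A * B). intros n z Hn Hz.
  assert (Hn2 : 0 < INR n ^ 2) by (apply pow_lt, lt_0_INR; lia).
  pose (part (c : nat -> C) (N : nat) (x : R) := sum_n (fun i => (c i * RtoC x ^ i)%C) N).
  pose (part' (c : nat -> C) := sum_n (fun i => (c i * (RtoC (INR i) * z ^ pred i))%C)).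
  assert (Hpart : forall h c, (forall z : C, Cmod z < R0 ->
       is_series (fun k : nat => (c k * pow_n z k)%C) (h z)) ->
       forall x, 0 <= x <= 1 -> Ccv (fun N => part c N x) (h (RtoC x))).
  { intros h c Hh x Hx. apply is_series_Ccv.
    apply (is_series_ext (fun k => (c k * pow_n (RtoC x) k)%C)).
    - intros k. now rewrite pow_n_Cpow.
    (* The segment [[0,1]] lies in the disc because [1 <= r < R0]. *)
    - apply Hh. rewrite Cmod_R, Rabs_pos_eq; lra. }
  (* With [n] and [z] fixed, the remainders of the partial sums converge to the expression of the
     theorem. *)
  apply (Ccv_bound (fun N => remainder n z (part a N) (part' a N) (part b N) (part' b N))).
  - unfold remainder.
    assert (Hpf := Hpart f a Hf). assert (Hpg := Hpart g b Hg).
    assert (Hdf := power_series_C_derive R0 r f a z Hr Hr0 Hz Hf).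
    assert (Hdg := power_series_C_derive R0 r g b z Hr Hr0 Hz Hg).
    apply Ccv_minus; [apply Ccv_minus|].
    + apply (bernstein_Ccv n (fun N x => part a N x * part b N x)%C _ z Hn).
      intros x Hx. exact (Ccv_mult _ _ _ _ (Hpf x Hx) (Hpg x Hx)).
    + exact (Ccv_mult _ _ _ _ (bernstein_Ccv n _ _ z Hn Hpf) (bernstein_Ccv n _ _ z Hn Hpg)).
    + apply Ccv_mult; [|apply Ccv_const].
      exact (Ccv_mult _ _ _ _ (Ccv_mult _ _ _ _ (Ccv_const (z * (1 - z))%C) Hdf) Hdg).
  - intros N.
    eapply Rle_trans; [apply remainder_sum_bound; intros i j; now apply (remainder_pow_bound n z r)|].
    replace (48 * A * B / INR n ^ 2) with (48 / INR n ^ 2 * A * B) by (field; apply not_0_INR; lia).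
    assert (H48 : 0 <= 48 / INR n ^ 2) by (apply Rle_div_r; lra).
    assert (Hpos : forall (c : nat -> C),
      0 <= sum_n (fun i => Cmod (c i) * ((INR i + 1) ^ 4 * r ^ i)) N).
    (* Every weight is at least 1, so the weighted sum dominates the modulus of the plain sum. *)
    { intros c. eapply Rle_trans; [apply Cmod_ge_0|].
      eapply Rle_trans; [apply (Cmod_sum_n c)|]. apply sum_n_m_le. intros i.
      rewrite <- Rmult_1_r at 1. apply Rmult_le_compat_l; [apply Cmod_ge_0|].
      rewrite <- (Rmult_1_l 1). pose proof (pos_INR i).
      apply Rmult_le_compat; try lra; apply pow_R1_Rle; lra. }
    apply Rmult_le_compat.
    + apply Rmult_le_pos; [exact H48 | apply Hpos].
    + apply Hpos.
    + apply Rmult_le_compat_l; [exact H48|].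
      eapply Rle_trans; [apply Rle_abs | apply HA].
    + eapply Rle_trans; [apply Rle_abs | apply HB].
Qed.
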